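(* Let $P=(X,\prec)$ be an interval order. A fundamental extender $S$ of $P$ is a Hilbert set if and only if $S$ is not the disjoint union of fundamental extenders that are proper subsets of $S$.
   Context: A finite (strictly) partially ordered set $P=(X,\prec)$, $X=\{1,\dots,n\}$, is an interval order if there are compact real intervals $[\ell_x,r_x]$, $x\in X$, with $\ell_x\le r_x$, such that $x\prec y$ if and only if $r_x<\ell_y$. Interval representations are moreover required to satisfy $r_x+1\le \ell_y$ for all $x\prec y$. A natural representation is one in which all endpoints are non-negative integers. The magnitude $m$ of $P$ is the number of distinct down-sets $D(z)=\{x: x\prec z\}$, $z\in X$. The canonical representation of $P$ is the (unique) natural representation whose set of interval endpoints is $\{0,1,\dots,m-1\}$. The length polyhedron $Q_P\subset\mathbb{R}^n$ is the set of all vectors $(r_x-\ell_x)_{x\in X}$ over all interval representations of $P$ with real endpoints (satisfying $r_x+1\le\ell_y$ for all $x\prec y$). Let $\boldsymbol{\rho^*}$ be the vector of interval lengths of the canonical representation. Then $Q_P=\boldsymbol{\rho^*}+Q_P^*$, where $Q_P^*=\{v-\boldsymbol{\rho^*}: v\in Q_P\}$ is a pointed rational cone. Let $[\ell_x,r_x]$, $x\in X$, now denote the intervals of the canonical representation. For $1\le i\le m-1$ the $i$th gap set is $\mathcal{G}_i=\{x\in X:\ell_x\le i-1\text{ and } i\le r_x\}$, and $\mathcal{G}_0=\mathcal{G}_m=\varnothing$. For $0\le i\le m$ the left- and right-borderline sets are $\mathcal{L}_i=\{x\in X: r_x=i-1\}$ and $\mathcal{R}_i=\{x\in X:\ell_x=i\}$.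 A non-empty set $S\subseteq X$ is a fundamental extender if there are an index $0\le i\le m$ and a set $Z$ with $Z\subseteq\mathcal{L}_i$ or $Z\subseteq\mathcal{R}_i$ such that $S=\mathcal{G}_i\cup Z$. $\mathcal{E}_P$ is the collection of all fundamental extenders. An integral Hilbert basis of a polyhedral cone is a finite set of integral vectors of the cone such that each integral vector in the cone is a non-negative integral linear combination of vectors from this set. A pointed rational cone has a unique (inclusion-)minimal integral Hilbert basis. For $Q_P^*$ it is contained in the set of characteristic vectors of the sets in $\mathcal{E}_P$. A set $S\subseteq X$ is a Hilbert set if $S\in\mathcal{E}_P$ and its characteristic vector belongs to the unique minimal integral Hilbert basis of $Q_P^*$. *)

(* Defs.v *)
From HB Require Import structures.
From mathcomp Require Import all_boot all_order all_algebra finmap.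
From mathcomp Require Import boolp classical_sets reals.

Set Implicit Arguments.
Unset Strict Implicit.
Unset Printing Implicit Defensive.

Import Order.TTheory GRing.Theory Num.Theory.
Local Open Scope ring_scope.

(* The ground set {1, ..., n} is rendered as 'I_n, the strict order as a       *)
(* boolean relation prec, and [l x, r x] is the interval assigned to x.        *)

Definition interval_order (R : realType) (n : nat) (prec : rel 'I_n) : Prop :=
  [/\ irreflexive prec, transitive prec &
      exists l r : 'I_n -> R,
        (forall x, l x <= r x) /\ (forall x y, prec x y <-> r x < l y)].

Definition representation (R : realType) (n : nat) (prec : rel 'I_n)
    (l r : 'I_n -> R) : Prop :=
  [/\ forall x, l x <= r x,
      forall x y, prec x y <-> r x < l y &
      forall x y, prec x y -> r x + 1 <= l y].

Definition natural_representation (R : realType) (n : nat) (prec : rel 'I_n)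
    (l r : 'I_n -> R) : Prop :=
  representation prec l r /\
  forall x, l x \is a Num.nat /\ r x \is a Num.nat.

Definition down_set (n : nat) (prec : rel 'I_n) (z : 'I_n) : {set 'I_n} :=
  [set x | prec x z].

Definition magnitude (n : nat) (prec : rel 'I_n) : nat :=
  #|[set down_set prec z | z : 'I_n]|.

Definition canonical_representation (R : realType) (n : nat) (prec : rel 'I_n)
    (l r : 'I_n -> R) : Prop :=
  natural_representation prec l r /\
  forall t : R, (exists x, t = l x \/ t = r x) <->
                (exists2 k : nat, (k < magnitude prec)%N & t = k%:R).

Definition length_vector (R : realType) (n : nat) (l r : 'I_n -> R) : 'rV[R]_n :=
  \row_x (r x - l x).

Definition length_polyhedron (R : realType) (n : nat) (prec : rel 'I_n) :
    set 'rV[R]_n :=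
  fun v => exists l r : 'I_n -> R,
    representation prec l r /\ v = length_vector l r.

(* The cone Q_P^*; in this and the definitions below, (l, r) is meant to be    *)
(* the canonical representation.                                               *)
Definition length_cone (R : realType) (n : nat) (prec : rel 'I_n)
    (l r : 'I_n -> R) : set 'rV[R]_n :=
  fun w => exists2 v, length_polyhedron prec v & w = v - length_vector l r.

Definition gap_set (R : realType) (n : nat) (prec : rel 'I_n)
    (l r : 'I_n -> R) (i : nat) : {set 'I_n} :=
  if (0 < i < magnitude prec)%N
  then [set x | (l x <= i%:R - 1) && (i%:R <= r x)] else finset.set0.

(* i%:R - 1 is subtraction in R, so left_borderline r 0 is {x | r x = -1}.     *)
Definition left_borderline (R : realType) (n : nat) (r : 'I_n -> R) (i : nat) :
    {set 'I_n} := [set x | r x == i%:R - 1].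

Definition right_borderline (R : realType) (n : nat) (l : 'I_n -> R) (i : nat) :
    {set 'I_n} := [set x | l x == i%:R].

Definition fundamental_extender (R : realType) (n : nat) (prec : rel 'I_n)
    (l r : 'I_n -> R) (S : {set 'I_n}) : Prop :=
  S != finset.set0 /\
  exists i : nat, (i <= magnitude prec)%N /\
  exists Z : {set 'I_n},
    (Z \subset left_borderline r i \/ Z \subset right_borderline l i) /\
    S = gap_set prec l r i :|: Z.

Definition integral_vector (R : realType) (n : nat) (v : 'rV[R]_n) : Prop :=
  forall x, v ord0 x \is a Num.int.

Definition integral_hilbert_basis (R : realType) (n : nat)
    (C : set 'rV[R]_n) (B : {fset 'rV[R]_n}) : Prop :=
  (forall b, b \in B -> C b /\ integral_vector b) /\
  (forall v, C v -> integral_vector v ->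
     exists c : 'rV[R]_n -> nat, v = \sum_(b <- B) b *+ c b).

Definition minimal_integral_hilbert_basis (R : realType) (n : nat)
    (C : set 'rV[R]_n) (B : {fset 'rV[R]_n}) : Prop :=
  integral_hilbert_basis C B /\
  forall B' : {fset 'rV[R]_n},
    integral_hilbert_basis C B' -> (B' `<=` B)%fset -> B' = B.

Definition char_vector (R : realType) (n : nat) (S : {set 'I_n}) : 'rV[R]_n :=
  \row_x (x \in S)%:R.

(* `unique' makes B the (one and only) minimal integral Hilbert basis.         *)
Definition hilbert_set (R : realType) (n : nat) (prec : rel 'I_n)
    (l r : 'I_n -> R) (S : {set 'I_n}) : Prop :=
  fundamental_extender prec l r S /\
  exists B : {fset 'rV[R]_n},
    unique (minimal_integral_hilbert_basis (length_cone prec l r)) B /\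
    char_vector R S \in B.

(* Main.v *)
Require Import Defs.
From HB Require Import structures.
From mathcomp Require Import all_boot all_order all_algebra finmap.
From mathcomp Require Import boolp classical_sets reals.
From mathcomp Require Import zify ring lra.

Set Implicit Arguments.
Unset Strict Implicit.
Unset Printing Implicit Defensive.

Import Order.TTheory GRing.Theory Num.Theory.
Local Open Scope ring_scope.

(** Let [a x] and [b x] be the endpoints of the interval of [x] in the canonical
    representation. Every level from 0 to [m - 1] is both a left and a right
    endpoint, so a pair of real functions is a representation as soon as it
    satisfies the constraints between endpoints at the same level and between
    right endpoints at one level and left endpoints at the next. The canonical
    representation makes these constraints tight. In terms of the displacements
    [p] of left endpoints and [q] of right endpoints they therefore say only
    that the displacements are monotone along the groups of endpoints
    L_0, R_0, L_1, R_1, ..., and the cone of the theorem is the set of all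
    [q - p] with [(p, q)] monotone ([length_coneP]). In particular it is closed
    under addition.

    If [q - p] is integral, translation and rounding down make [p] and [q]
    natural-valued, and such a pair is the sum of its two-valued layers. A
    monotone two-valued displacement is a threshold somewhere among the groups,
    and the intervals that it lengthens form exactly a fundamental extender, or
    the empty set ([fundamental_extenderP]). Hence the integral vectors of the
    cone are exactly the sums of characteristic vectors of fundamental extenders
    ([integral_length_coneP]).

    Summands of a characteristic vector of a set are characteristic vectors of
    disjoint sets. So the extenders that are not disjoint unions of smaller ones
    give the irreducible integral vectors: they belong to every integral Hilbert
    basis ([indecomposable_in_basis]), and by induction on the cardinality they
    generate all extenders ([indecomposable_hilbert_basis]). Their
    characteristic vectors thus form the least integral Hilbert basis. *)

(** * Endpoints as levels *)

(** The natural numbers [a x <= b x] are the endpoints of the canonical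
    representation [(l, r)]. The last two clauses say that each of the [m]
    levels below the magnitude is both a left and a right endpoint. *)
Definition endpoint_levels (R : realType) (n : nat) (prec : rel 'I_n)
    (l r : 'I_n -> R) (a b : 'I_n -> nat) : Prop :=
  [/\ forall x, l x = (a x)%:R /\ r x = (b x)%:R,
      forall x y, prec x y = (b x < a y)%N,
      forall x, (a x <= b x < magnitude prec)%N,
      forall k, (k < magnitude prec)%N -> exists x, a x = k &
      forall k, (k < magnitude prec)%N -> exists x, b x = k].

(** The down-set of [z] is determined by the level [a z], and there are as many
    down-sets as levels; hence every level is a left endpoint and different
    levels have different down-sets. *)
Lemma canonical_endpoint_levels (R : realType) (n : nat) (prec : rel 'I_n)
    (l r : 'I_n -> R) :
  canonical_representation prec l r ->
  exists a b, endpoint_levels prec l r a b.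
Proof.
move=> [[[lr_le precP _] lrN] ends].
pose a x := Num.truncn (l x); pose b x := Num.truncn (r x).
have lE x : l x = (a x)%:R by rewrite truncnK //; case: (lrN x).
have rE x : r x = (b x)%:R by rewrite truncnK //; case: (lrN x).
have ab x : (a x <= b x)%N by rewrite -(ler_nat R) -lE -rE.
have precE x y : prec x y = (b x < a y)%N.
  by apply/idP/idP => [/precP|]; rewrite -?(ltr_nat R) -?lE -?rE // => /precP.
set m := magnitude prec.
have bm x : (b x < m)%N.
  have [k km /eqP] : exists2 k : nat, (k < m)%N & r x = k%:R.
    by apply/ends; exists x; right.
  by rewrite rE eqr_nat => /eqP ->.
have am x : (a x < m)%N := leq_ltn_trans (ab x) (bm x).
exists a, b.
pose A x : 'I_m := Ordinal (am x).
pose below (k : 'I_m) : {set 'I_n} := [set x | (b x < k)%N].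
have downE : [set down_set prec z | z : 'I_n] = below @: (A @: [set: 'I_n]).
  apply/setP => D; apply/imsetP/imsetP => [[z _ ->]|[_ /imsetP[z _ ->] ->]].
    exists (A z); first by rewrite imset_f ?inE.
    by apply/setP => x; rewrite !inE precE.
  by exists z => //; apply/setP => x; rewrite !inE precE.
have cardD : #|below @: (A @: [set: 'I_n])| = m by rewrite -downE.
have cardA : #|A @: [set: 'I_n]| = m.
  apply/eqP; rewrite eqn_leq; apply/andP; split.
    by rewrite -[leqRHS](card_ord m) max_card.
  by rewrite -[leqLHS]cardD leq_imset_card.
have Afull : A @: [set: 'I_n] = [set: 'I_m].
  by apply/eqP; rewrite eqEcard finset.subsetT cardsT card_ord cardA leqnn.
have below_inj : {in [set: 'I_m] &, injective below}.
  by apply/imset_injP; rewrite -Afull cardD cardA.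
have a_surj k : (k < m)%N -> exists x, a x = k.
  move=> km; have : Ordinal km \in A @: [set: 'I_n] by rewrite Afull inE.
  by case/imsetP => x _ /(congr1 val) /= ->; exists x.
split=> // [x|k]; first by rewrite ab bm.
rewrite leq_eqVlt => /orP[/eqP mE|k1m].
  (* the interval starting on the last level also ends there *)
  have [|x ax] := a_surj k; first by rewrite -/m; lia.
  by exists x; have := ab x; have := bm x; lia.
have km : (k < m)%N by lia.
case: (pselect (exists x, b x = k)) => // nb.
have /(congr1 val) /= : Ordinal km = Ordinal k1m; last lia.
apply: below_inj; rewrite ?inE //; apply/setP => x; rewrite !inE /=.
have : b x <> k by move=> bx; apply: nb; exists x.
lia.
Qed.

Lemma gap_setE (R : realType) (n : nat) (prec : rel 'I_n) (l r : 'I_n -> R)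
    (a b : 'I_n -> nat) (i : nat) (x : 'I_n) :
  endpoint_levels prec l r a b ->
  (x \in gap_set prec l r i) = (a x < i <= b x)%N.
Proof.
move=> [lrE _ abm _ _]; rewrite /gap_set; have [lE rE] := lrE x.
have abmx := abm x; case: ifP => [/andP[i0 im]|im]; rewrite inE; last lia.
by rewrite lE rE lerBrDr natr1 !ler_nat.
Qed.

Lemma left_borderlineE (R : realType) (n : nat) (prec : rel 'I_n)
    (l r : 'I_n -> R) (a b : 'I_n -> nat) (i : nat) (x : 'I_n) :
  endpoint_levels prec l r a b ->
  (x \in left_borderline r i) = ((b x).+1 == i).
Proof.
move=> [lrE _ _ _ _]; have [_ rE] := lrE x.
by rewrite inE rE eq_sym subr_eq natr1 eqr_nat eq_sym.
Qed.

Lemma right_borderlineE (R : realType) (n : nat) (prec : rel 'I_n)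
    (l r : 'I_n -> R) (a b : 'I_n -> nat) (i : nat) (x : 'I_n) :
  endpoint_levels prec l r a b ->
  (x \in right_borderline l i) = (a x == i).
Proof. by move=> [lrE _ _ _ _]; have [lE _] := lrE x; rewrite inE lE eqr_nat. Qed.

(** * The length cone as a cone of displacements *)

(** Endpoints [a x] and [b x] are moved by [p x] and [q x], and the moves are
    monotone along the order
    left endpoints at 0, right endpoints at 0, left endpoints at 1, and so on.
    Only consecutive groups are compared here. *)
Definition monotone_shift (T : Type) (le : rel T) (n : nat) (a b : 'I_n -> nat)
    (p q : 'I_n -> T) : Prop :=
  (forall x y, a x = b y -> le (p x) (q y)) /\
  (forall x y, a x = (b y).+1 -> le (q y) (p x)).

(** Since no group is empty, monotonicity between consecutive groups propagates
    to all pairs of endpoints. *)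
Lemma monotone_shift_chain (R : realType) (n : nat) (prec : rel 'I_n)
    (l r : 'I_n -> R) (a b : 'I_n -> nat)
    (T : Type) (le : rel T) (p q : 'I_n -> T) :
  endpoint_levels prec l r a b -> transitive le ->
  monotone_shift le a b p q ->
  (forall x y, (a x <= b y)%N -> le (p x) (q y)) /\
  (forall x y, (b y < a x)%N -> le (q y) (p x)).
Proof.
move=> [_ _ abm a_surj b_surj] le_trans [pq qp].
have chain d x y : b y = (a x + d)%N -> le (p x) (q y).
  elim: d y => [|d IH] y bE; first by apply: pq; rewrite bE addn0.
  have /andP[_ bm] := abm y.
  have [|z bz] := b_surj (a x + d)%N; first lia.
  have [|t ta] := a_surj (a x + d).+1; first lia.
  apply: (le_trans _ _ _ (IH z bz)); apply: (le_trans (p t)).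
    by apply: qp; lia.
  by apply: pq; lia.
have le_pq x y : (a x <= b y)%N -> le (p x) (q y).
  by move=> xy; apply: (chain (b y - a x)%N); lia.
split=> // x y yx; have abmx := abm x.
have [|z az] := a_surj (b y).+1; first lia.
have le_qp : le (q y) (p z) by apply: qp.
case: (ltngtP (b y).+1 (a x)) => [ltyx| |eqyx]; [|lia|by apply: qp; lia].
have [|t bt] := b_surj (a x).-1; first lia.
apply: (le_trans _ _ _ le_qp); apply: (le_trans (q t)); first by apply: le_pq; lia.
by apply: qp; lia.
Qed.

(** In any representation a right endpoint at level [i] is at distance at least
    1 from each left endpoint at level [i + 1], and at least any left endpoint
    at level [i]. After subtraction of the canonical representation, for which
    these inequalities are tight, the constraints on the displacements are
    homogeneous. *)
Lemma length_coneP (R : realType) (n : nat) (prec : rel 'I_n)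
    (l r : 'I_n -> R) (a b : 'I_n -> nat) (w : 'rV[R]_n) :
  endpoint_levels prec l r a b ->
  length_cone prec l r w <->
  exists p q, monotone_shift <=%R a b p q /\ w = \row_x (q x - p x).
Proof.
move=> lev; have [lrE precE abm _ _] := lev.
have lE x : l x = (a x)%:R by case: (lrE x).
have rE x : r x = (b x)%:R by case: (lrE x).
split=> [[v [l' [r' [[_ precP prec1] ->]]] ->]|[p [q [pq ->]]]].
  exists (fun x => l' x - l x), (fun x => r' x - r x); split; last first.
    by apply/rowP => x; rewrite !mxE; ring.
  split=> x y ab; rewrite lE rE ab.
    rewrite lerB // leNgt; apply/negP => /precP.
    by rewrite precE ab ltnn.
  have : r' y + 1 <= l' x by apply: prec1; rewrite precE ab.
  by rewrite -natr1; lra.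
have [le_pq le_qp] := monotone_shift_chain lev le_trans pq.
exists (length_vector (fun x => l x + p x) (fun x => r x + q x)); last first.
  by apply/rowP => x; rewrite !mxE; ring.
exists (fun x => l x + p x), (fun x => r x + q x); split=> //.
have far x y : prec x y -> r x + q x + 1 <= l y + p y.
  rewrite precE => xy; rewrite addrAC lE rE lerD ?le_qp //.
  by rewrite natr1 ler_nat.
split=> // [x|x y].
  have /andP[ab _] := abm x.
  by rewrite lE rE lerD ?ler_nat ?le_pq.
split=> [/far|]; first by apply: lt_le_trans; rewrite ltrDl ltr01.
apply: contraTT; rewrite precE -leqNgt -leNgt => yx.
by rewrite lE rE lerD ?ler_nat ?le_pq.
Qed.

(** * Fundamental extenders as two-valued displacements *)

(** A monotone two-valued displacement is given by a threshold in the order of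
    the groups of endpoints, together with the moved part of the group in which
    the threshold lies. The intervals that grow are those of the gap set at the
    threshold and some of those that are borderline there: left-borderline if
    the group consists of right endpoints, right-borderline otherwise. *)
Lemma fundamental_extenderP (R : realType) (n : nat) (prec : rel 'I_n)
    (l r : 'I_n -> R) (a b : 'I_n -> nat) (T : {set 'I_n}) :
  endpoint_levels prec l r a b ->
  fundamental_extender prec l r T <->
  T != finset.set0 /\
  exists p q : 'I_n -> bool,
    monotone_shift implb a b p q /\ T = [set x | q x && ~~ p x].
Proof.
move=> lev; have [_ _ abm a_surj b_surj] := lev.
split=> [[T0 [i [im [Z [Zi TE]]]]]|[T0 [p [q [pq TE]]]]]; split=> //.
  case: Zi => /fintype.subsetP Zi.
    exists (fun x => i <= a x)%N, (fun x => (i <= b x)%N || (x \in Z)).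
    split; first split=> x y ab; first by apply/implyP => ?; apply/orP; left; lia.
      apply/implyP => /orP[|/Zi]; first lia.
      by rewrite (left_borderlineE _ _ lev) => /eqP; lia.
    apply/setP => x; rewrite TE !inE (gap_setE _ _ lev).
    have abx := abm x; case xZ: (x \in Z); last by rewrite orbF; lia.
    by move: (Zi x xZ); rewrite (left_borderlineE _ _ lev) => /eqP; lia.
  exists (fun x => (i <= a x)%N && (x \notin Z)), (fun x => (i <= b x)%N).
  split; first split=> x y ab.
  - by apply/implyP => /andP[]; lia.
  - apply/implyP => iy; apply/andP; split; first lia.
    by apply/negP => /Zi; rewrite (right_borderlineE _ _ lev) => /eqP; lia.
  apply/setP => x; rewrite TE !inE (gap_setE _ _ lev).
  have abx := abm x; case xZ: (x \in Z); last by rewrite orbF andbT; lia.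
  move: (Zi x xZ); rewrite (right_borderlineE _ _ lev) => /eqP.
  by rewrite andbF orbT andbT; lia.
have implb_trans : transitive implb by move=> [] [] [].
have [le_pq le_qp] := monotone_shift_chain lev implb_trans pq.
have [z0] := set0Pn _ T0.
rewrite TE inE => /andP[qz0 _].
(* [b z] is the lowest level with a moved right endpoint *)
pose z := [arg min_(z < z0 | q z) b z].
have [qz z_min] : q z /\ forall y, q y -> (b z <= b y)%N.
  by rewrite /z; case: arg_minnP.
have p_low x : (a x < b z)%N -> ~~ p x.
  move=> lt_xz; have [|y bE] := b_surj (a x); first by have := abm x; lia.
  apply/negP => px; have := le_pq x y; rewrite bE px leqnn => /(_ isT) qy.
  by have := z_min y qy; lia.
have p_high x : (b z < a x)%N -> p x by move=> /le_qp; rewrite qz.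
have q_high x : (b z < b x)%N -> q x.
  move=> lt_zx; have [|y ay] := a_surj (b x); first by have := abm x; lia.
  have := le_pq y x; rewrite ay leqnn => /(_ isT); rewrite p_high ?ay //.
have q_low x : (b x < b z)%N -> q x = false.
  by move=> lt_xz; apply/negP => /z_min; lia.
case: (pselect (exists2 t, a t = b z & p t)) => [[t ta pt]|p_none].
  exists (b z); split; first by have := abm z; lia.
  exists [set x | (a x == b z) && ~~ p x]; split.
    right; apply/fintype.subsetP => x; rewrite (right_borderlineE _ _ lev) inE.
    by case/andP.
  have q_mid x : b x = b z -> q x.
    by move=> bx; have := le_pq t x; rewrite pt ta bx leqnn => /(_ isT).
  apply/setP => x; rewrite !inE (gap_setE _ _ lev); have abx := abm x.
  case: (ltngtP (b x) (b z)) => bx.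
  - by rewrite q_low // andbF /=; case: eqP => //=; lia.
  - rewrite q_high //= andbT.
    case: (ltngtP (a x) (b z)) => ax /=; by [rewrite p_low|rewrite p_high|].
  - rewrite q_mid //= andbT.
    case: (ltngtP (a x) (b z)) => ax /=; by [rewrite p_low|lia|].
exists (b z).+1; split; first by have := abm z; lia.
exists [set x | (b x == b z) && q x]; split.
  left; apply/fintype.subsetP => x; rewrite (left_borderlineE _ _ lev) inE.
  by case/andP => /eqP ->.
have p_mid x : a x = b z -> p x = false.
  by move=> ax; apply/negP => px; apply: p_none; exists x.
apply/setP => x; rewrite !inE (gap_setE _ _ lev); have abx := abm x.
case: (ltngtP (b x) (b z)) => bx /=.
- by rewrite q_low // andbF.
- rewrite q_high // orbF andbT ltnS /=.
  case: (ltngtP (a x) (b z)) => ax /=; by [rewrite p_low|rewrite p_high|rewrite p_mid].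
- rewrite andbF /=; case: (q x) => //=.
  case: (ltngtP (a x) (b z)) => ax; by [rewrite p_low|lia|rewrite p_mid].
Qed.

(** * Integral vectors of the length cone *)

(** The vector [v] is a sum of characteristic vectors of fundamental extenders,
    with multiplicities given by the repetitions in the sequence [s]. *)
Definition extender_sum (R : realType) (n : nat) (prec : rel 'I_n)
    (l r : 'I_n -> R) (v : 'rV[R]_n) : Prop :=
  exists s : seq {set 'I_n},
    (forall T, T \in s -> fundamental_extender prec l r T) /\
    v = \sum_(T <- s) char_vector R T.

Lemma extender_sum0 (R : realType) (n : nat) (prec : rel 'I_n)
    (l r : 'I_n -> R) : extender_sum prec l r 0.
Proof. by exists [::]; rewrite big_nil. Qed.

Lemma extender_sumD (R : realType) (n : nat) (prec : rel 'I_n)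
    (l r : 'I_n -> R) (v w : 'rV[R]_n) :
  extender_sum prec l r v -> extender_sum prec l r w ->
  extender_sum prec l r (v + w).
Proof.
move=> [s [sE ->]] [t [tE ->]]; exists (s ++ t); rewrite big_cat; split=> // T.
by rewrite mem_cat => /orP[/sE|/tE].
Qed.

Lemma extender_sumMn (R : realType) (n : nat) (prec : rel 'I_n)
    (l r : 'I_n -> R) (v : 'rV[R]_n) (k : nat) :
  extender_sum prec l r v -> extender_sum prec l r (v *+ k).
Proof.
move=> vE; elim: k => [|k IH]; first by rewrite mulr0n; apply: extender_sum0.
by rewrite mulrS; apply: extender_sumD.
Qed.

Lemma length_cone0 (R : realType) (n : nat) (prec : rel 'I_n)
    (l r : 'I_n -> R) (a b : 'I_n -> nat) :
  endpoint_levels prec l r a b -> length_cone prec l r 0.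
Proof.
move=> lev; apply/(length_coneP _ lev); exists (fun=> 0), (fun=> 0).
by split=> //; apply/rowP => x; rewrite !mxE subrr.
Qed.

Lemma length_coneD (R : realType) (n : nat) (prec : rel 'I_n)
    (l r : 'I_n -> R) (a b : 'I_n -> nat) (v w : 'rV[R]_n) :
  endpoint_levels prec l r a b ->
  length_cone prec l r v -> length_cone prec l r w ->
  length_cone prec l r (v + w).
Proof.
move=> lev /(length_coneP _ lev)[p [q [[pq qp] ->]]].
move=> /(length_coneP _ lev)[p' [q' [[pq' qp'] ->]]].
apply/(length_coneP _ lev); exists (fun x => p x + p' x), (fun x => q x + q' x).
split; last by apply/rowP => x; rewrite !mxE; ring.
by split=> x y ab; rewrite lerD ?pq ?pq' ?qp ?qp'.
Qed.

Lemma length_cone_char_vector (R : realType) (n : nat) (prec : rel 'I_n)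
    (l r : 'I_n -> R) (a b : 'I_n -> nat) (T : {set 'I_n}) :
  endpoint_levels prec l r a b ->
  fundamental_extender prec l r T -> length_cone prec l r (char_vector R T).
Proof.
move=> lev /(fundamental_extenderP _ lev)[_ [p [q [pq ->]]]].
have implb_trans : transitive implb by move=> [] [] [].
have [le_pq _] := monotone_shift_chain lev implb_trans pq.
have [_ _ abm _ _] := lev.
apply/(length_coneP _ lev); exists (fun x => (p x)%:R), (fun x => (q x)%:R).
split; last first.
  apply/rowP => x; rewrite !mxE inE; have /andP[/le_pq] := abm x.
  by case: (p x) (q x) => [] [] //= _ _; rewrite ?subrr ?subr0.
case: pq => pq qp; split=> x y ab; rewrite ler_nat.
  by have := pq x y ab; case: (p x) (q y) => [] [].
by have := qp x y ab; case: (q y) (p x) => [] [].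
Qed.

Lemma extender_sum_in_cone (R : realType) (n : nat) (prec : rel 'I_n)
    (l r : 'I_n -> R) (a b : 'I_n -> nat) (v : 'rV[R]_n) :
  endpoint_levels prec l r a b ->
  extender_sum prec l r v -> length_cone prec l r v /\ integral_vector v.
Proof.
move=> lev [s [sE ->]]; split; last first.
  move=> x; rewrite summxE rpred_sum // => T _.
  by rewrite mxE; case: (x \in T); rewrite ?rpred1 ?rpred0.
elim: s sE => [|T s IH] sE; first by rewrite big_nil; apply: length_cone0 lev.
rewrite big_cons; apply: (length_coneD lev).
  by apply: (length_cone_char_vector lev); apply: sE; rewrite mem_head.
by apply: IH => U Us; apply: sE; rewrite inE Us orbT.
Qed.

(** A displacement with values in the natural numbers is the sum over [t] of its
    two-valued layers [t < p], [t < q], each of which extends by a fundamental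
    extender or does not change the lengths. *)
Lemma extender_sum_natshift (R : realType) (n : nat) (prec : rel 'I_n)
    (l r : 'I_n -> R) (a b : 'I_n -> nat) (p q : 'I_n -> nat) :
  endpoint_levels prec l r a b -> monotone_shift leq a b p q ->
  extender_sum prec l r (\row_x ((q x)%:R - (p x)%:R)).
Proof.
move=> lev pq; have [_ _ abm _ _] := lev.
have [le_pq _] := monotone_shift_chain lev leq_trans pq.
pose layer t : {set 'I_n} := [set x | (t < q x)%N && ~~ (t < p x)%N].
pose N := (\max_x q x)%N.
have -> : \row_x ((q x)%:R - (p x)%:R) = \sum_(t < N) char_vector R (layer t).
  apply/rowP => x; rewrite summxE mxE.
  have pqx : (p x <= q x)%N by apply: le_pq; case/andP: (abm x).
  have qN : (q x <= N)%N by apply: leq_bigmax.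
  rewrite -natrB //; under eq_bigr do rewrite mxE inE.
  rewrite -natr_sum; congr (_%:R).
  (* [q x - p x] counts the [t] with [p x <= t < q x] *)
  transitivity (\sum_(t < N | (p x <= t < q x)%N) 1)%N.
    rewrite -(big_mkord (fun t => p x <= t < q x)%N (fun=> 1%N)).
    rewrite (big_cat_nat (n := p x)) //=; last exact: leq_trans qN.
    rewrite big_nat_cond big_pred0 ?add0n; last by move=> t; lia.
    rewrite (big_cat_nat (n := q x)) //=.
    rewrite [X in (_ + X)%N]big_nat_cond [X in (_ + X)%N]big_pred0 ?addn0; last first.
      by move=> t; lia.
    rewrite big_nat_cond (eq_bigl (fun t => p x <= t < q x)%N); last by move=> t; lia.
    by rewrite -big_nat sum_nat_const_nat muln1.
  rewrite big_mkcond /=; apply: eq_bigr => t _.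
  by rewrite -leqNgt andbC; case: ifP.
elim/big_ind: _ => [|v w|t _]; [exact: extender_sum0|exact: extender_sumD|].
have [layer0|layerN0] := eqVneq (layer t) finset.set0.
  suff -> : char_vector R (layer t) = 0 by apply: extender_sum0.
  by apply/rowP => x; rewrite !mxE layer0 inE.
exists [:: layer t]; rewrite big_seq1; split=> // T; rewrite inE => /eqP ->.
apply/(fundamental_extenderP _ lev); split=> //.
exists (fun x => t < p x)%N, (fun x => t < q x)%N; split=> //.
by case: pq => pq qp; split=> x y ab; apply/implyP => /leq_trans; apply; auto.
Qed.

(** Displacements producing integral length changes may be made integral: after
    a translation they are non-negative, and rounding down preserves both
    monotonicity and the integral differences. *)
Lemma integral_length_coneP (R : realType) (n : nat) (prec : rel 'I_n)
    (l r : 'I_n -> R) (a b : 'I_n -> nat) (w : 'rV[R]_n) :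
  endpoint_levels prec l r a b ->
  (length_cone prec l r w /\ integral_vector w) <-> extender_sum prec l r w.
Proof.
move=> lev; split; last exact: extender_sum_in_cone lev.
have [_ _ abm _ _] := lev.
move=> [/(length_coneP _ lev)[p [q [pq wE]]] wint].
have [le_pq _] := monotone_shift_chain lev (@le_trans _ R) pq.
have wnat x : q x - p x \is a Num.nat.
  have := wint x; rewrite wE mxE natrEint => ->.
  by rewrite subr_ge0 le_pq //; case/andP: (abm x).
pose M := Num.bound (\sum_x `|p x|).
have pM x : 0 <= p x + M%:R.
  have : `|p x| <= \sum_x `|p x|.
    by rewrite (bigD1 x) //= lerDl sumr_ge0 // => *; apply: normr_ge0.
  have : \sum_x `|p x| < M%:R by rewrite archi_boundP ?sumr_ge0.
  have := lerNnormlW (lexx `|p x|); lra.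
have qE x : Num.truncn (q x + M%:R) =
    (Num.truncn (q x - p x) + Num.truncn (p x + M%:R))%N.
  have -> : q x + M%:R = (q x - p x) + (p x + M%:R) by ring.
  by rewrite truncnD // nnegrE.
suff -> : w = \row_x ((Num.truncn (q x + M%:R))%:R - (Num.truncn (p x + M%:R))%:R).
  apply: (extender_sum_natshift lev); case: pq => pq qp.
  by split=> x y ab; apply: le_truncn; rewrite lerD2r ?pq ?qp.
by apply/rowP => x; rewrite wE !mxE qE natrD addrK truncnK.
Qed.

(** * The minimal integral Hilbert basis *)

(** A fundamental extender that is not a disjoint union of fundamental extenders
    properly contained in it. *)
Definition indecomposable_extender (R : realType) (n : nat) (prec : rel 'I_n)
    (l r : 'I_n -> R) (S : {set 'I_n}) : Prop :=
  fundamental_extender prec l r S /\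
  ~ (exists F : {set {set 'I_n}},
       finset.partition F S /\
       (forall T, T \in F -> fundamental_extender prec l r T /\ T \proper S)).

Lemma char_vector_inj (R : realType) (n : nat) : injective (@char_vector R n).
Proof.
move=> S T /rowP ST; apply/setP => x; have /eqP := ST x.
by rewrite !mxE eqr_nat; case: (x \in S) (x \in T) => [] [].
Qed.

Lemma char_vector_partition (R : realType) (n : nat) (S : {set 'I_n})
    (F : {set {set 'I_n}}) :
  finset.partition F S -> char_vector R S = \sum_(T in F) char_vector R T.
Proof.
move=> /and3P[/eqP covF trivF _]; apply/rowP => x; rewrite summxE mxE.
under eq_bigr do rewrite mxE.
have [xS|xS] := boolP (x \in S).
  have pF : finset.pblock F x \in F by rewrite finset.pblock_mem // covF.
  rewrite (bigD1 _ pF) /= finset.mem_pblock covF xS big1 ?addr0 // => T /andP[TF TP].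
  case xT: (x \in T) => //; case/eqP: TP.
  by rewrite -(finset.def_pblock trivF TF xT).
rewrite big1 // => T TF; case xT: (x \in T) => //.
by case/negP: xS; rewrite -covF; apply/finset.bigcupP; exists T.
Qed.

(** Fundamental extenders whose characteristic vectors add up to that of [S] are
    pairwise disjoint with union [S]. If [S] is not among them they partition
    it into proper subsets; if it is, there is no room for another one. *)
Lemma indecomposable_sum (R : realType) (n : nat) (prec : rel 'I_n)
    (l r : 'I_n -> R) (S : {set 'I_n}) (s : seq {set 'I_n}) :
  indecomposable_extender prec l r S ->
  (forall T, T \in s -> fundamental_extender prec l r T) ->
  char_vector R S = \sum_(T <- s) char_vector R T ->
  s = [:: S].
Proof.
move=> [[S0 _] indS] sE sumS.
have cnt x : (x \in S : nat) = count (fun T : {set 'I_n} => x \in T) s.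
  apply/eqP; rewrite -(eqr_nat R); move/rowP: sumS => /(_ x).
  rewrite summxE mxE => ->; rewrite -sum1_count natr_sum.
  by apply/eqP; rewrite [RHS]big_mkcond; apply: eq_bigr => T _;
    rewrite mxE; case: (x \in T).
have sub T : T \in s -> T \subset S.
  move=> Ts; apply/fintype.subsetP => x xT; have := cnt x.
  case: (x \in S) => // /esym/eqP; rewrite -leqn0 leqNgt -has_count.
  by case/hasP; exists T.
have [Ss|Ss] := boolP (S \in s).
  have [x xS] := set0Pn _ S0.
  have perm_s := perm_to_rem Ss.
  have rem0 : rem S s = [::].
    case E: (rem S s) => [//|T t].
    have Ts : T \in s by rewrite (perm_mem perm_s) E !inE eqxx orbT.
    have [/set0Pn[y yT] _] := sE T Ts.
    by have := cnt y; rewrite (permP perm_s) E /= yT (fintype.subsetP (sub T Ts)).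
  by rewrite rem0 in perm_s; apply: (perm_small_eq _ perm_s).
(* otherwise the members of [s] partition [S] into proper subsets *)
case: indS; exists [set T in s]; split; last first.
  move=> T; rewrite inE => Ts; split; first exact: sE.
  rewrite finset.properEneq sub // andbT.
  by apply: contraNneq Ss => <-.
apply/and3P; split.
- apply/eqP/setP => x; apply/finset.bigcupP/idP => [[T]|xS].
    by rewrite inE => /sub /fintype.subsetP; apply.
  have : has (fun T : {set 'I_n} => x \in T) s by rewrite has_count -cnt xS.
  by case/hasP => T Ts xT; exists T; rewrite ?inE.
- apply/finset.trivIsetP => T U; rewrite !inE => Ts Us TU.
  rewrite -setI_eq0; apply/set0Pn => -[x /finset.setIP[xT xU]].
  have perm_s := perm_to_rem Ts.
  have Ur : U \in rem T s.
    by move: Us; rewrite (perm_mem perm_s) inE eq_sym (negPf TU).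
  have := cnt x; rewrite (permP perm_s) /= xT.
  have : (0 < count (fun T : {set 'I_n} => x \in T) (rem T s))%N.
    by rewrite -has_count; apply/hasP; exists U.
  by case: (count _ _) => // k _; case: (x \in S).
- by rewrite inE; apply/negP => /sE[]; rewrite eqxx.
Qed.

(** Write the characteristic vector of the set over the basis. A summand [b]
    that occurs, and the rest of the sum, are integral vectors of the cone, so
    both are sums of fundamental extenders, and [b] is the only summand. *)
Lemma indecomposable_in_basis (R : realType) (n : nat) (prec : rel 'I_n)
    (l r : 'I_n -> R) (a b : 'I_n -> nat) (S : {set 'I_n})
    (B : {fset 'rV[R]_n}) :
  endpoint_levels prec l r a b ->
  integral_hilbert_basis (length_cone prec l r) B ->
  indecomposable_extender prec l r S -> char_vector R S \in B.
Proof.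
move=> lev [BC Bgen] indS; have [ES _] := indS.
have Bsum v : v \in B -> extender_sum prec l r v.
  by move=> /BC; apply: (integral_length_coneP _ lev).1.
have [|c cE] := Bgen (char_vector R S) (length_cone_char_vector lev ES).
  by move=> x; rewrite mxE; case: (x \in S); rewrite ?rpred1 ?rpred0.
have S_neq0 : char_vector R S != 0.
  case: (ES) => /set0Pn[x xS] _; apply/eqP => /rowP /(_ x) /eqP.
  by rewrite !mxE xS oner_eq0.
have /hasP[v vB /andP[v0 cv]] : has (fun v => (v != 0) && (0 < c v)%N) B.
  apply: contraTT S_neq0 => /hasPn none; rewrite negbK cE big_seq big1 // => v vB.
  have := none v vB; rewrite negb_and negbK -leqNgt leqn0.
  by case/orP => /eqP ->; rewrite ?mul0rn ?mulr0n.
have [s [sE vE]] := Bsum v vB.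
pose w := v *+ (c v).-1 + \sum_(u <- B | u != v) u *+ c u.
have [t [tE wE]] : extender_sum prec l r w.
  apply: extender_sumD; first exact/extender_sumMn/Bsum.
  rewrite big_seq_cond; elim/big_ind: _ => [|u u'|u /andP[uB _]].
  - exact: extender_sum0.
  - exact: extender_sumD.
  - exact/extender_sumMn/Bsum.
have stE : s ++ t = [:: S].
  apply: (indecomposable_sum (R := R) indS).
    by move=> T; rewrite mem_cat => /orP[/sE|/tE].
  rewrite big_cat /= -vE -wE cE (bigD1_seq v) ?fset_uniq //= /w addrA.
  by rewrite -mulrS prednK.
case: s vE stE {sE} => [|T s] vE; first by rewrite vE big_nil eqxx in v0.
case=> TS /eqP; rewrite -size_eq0 size_cat addn_eq0 size_eq0 => /andP[/eqP s0 _].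
by move: vE; rewrite s0 TS big_seq1 => <-.
Qed.

(** The characteristic vectors of the indecomposable fundamental extenders. *)
Definition indecomposable_basis (R : realType) (n : nat) (prec : rel 'I_n)
    (l r : 'I_n -> R) : {fset 'rV[R]_n} :=
  [fset char_vector R T | T in
     [set T : {set 'I_n} | `[< indecomposable_extender prec l r T >]]]%fset.

Lemma char_vector_in_basis (R : realType) (n : nat) (prec : rel 'I_n)
    (l r : 'I_n -> R) (S : {set 'I_n}) :
  char_vector R S \in indecomposable_basis prec l r <->
  indecomposable_extender prec l r S.
Proof.
split=> [/imfsetP[T /=]|indS].
  by rewrite inE => /asboolP indT /char_vector_inj ->.
by apply/imfsetP; exists S => //=; rewrite inE; apply/asboolP.
Qed.

Lemma indecomposable_hilbert_basis (R : realType) (n : nat) (prec : rel 'I_n)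
    (l r : 'I_n -> R) (a b : 'I_n -> nat) :
  endpoint_levels prec l r a b ->
  integral_hilbert_basis (length_cone prec l r) (indecomposable_basis prec l r).
Proof.
move=> lev; set B := indecomposable_basis prec l r; split.
  move=> v /imfsetP[T /= + ->]; rewrite inE => /asboolP[ET _].
  apply/(integral_length_coneP _ lev); exists [:: T]; rewrite big_seq1.
  by split=> // U; rewrite inE => /eqP ->.
pose gen (v : 'rV[R]_n) :=
  exists c : 'rV[R]_n -> nat, v = \sum_(u <- B) u *+ c u.
have gen0 : gen 0.
  by exists (fun=> 0%N); rewrite big1 // => u _; rewrite mulr0n.
have genD u v : gen u -> gen v -> gen (u + v).
  move=> [c ->] [d ->]; exists (fun x => c x + d x)%N; rewrite -big_split.
  by apply: eq_bigr => x _; rewrite mulrnDr.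
have genB v : v \in B -> gen v.
  move=> vB; exists (fun u => (u == v) : nat).
  rewrite (bigD1_seq v) ?fset_uniq //= eqxx mulr1n big1 ?addr0 // => u.
  by move/negPf ->; rewrite mulr0n.
have genE k (T : {set 'I_n}) : (#|T| < k)%N -> fundamental_extender prec l r T ->
    gen (char_vector R T).
  elim: k T => // k IH T; rewrite ltnS => Tk ET.
  case: (pselect (indecomposable_extender prec l r T)) => [indT|dec].
    by apply/genB/char_vector_in_basis.
  have [F [partF FE]] : exists F : {set {set 'I_n}}, finset.partition F T /\
      (forall U, U \in F -> fundamental_extender prec l r U /\ U \proper T).
    by apply: contrapT => nF; apply: dec.
  rewrite (char_vector_partition R partF); elim/big_ind: _ => // U /FE[EU UT].
  by apply: IH => //; apply: leq_trans (proper_card UT) Tk.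
move=> v vC vint.
have [s [sE ->]] := (integral_length_coneP v lev).1 (conj vC vint).
rewrite big_seq; elim/big_ind: _ => // T Ts.
by apply: genE (ltnSn _) _; apply: sE.
Qed.

Lemma indecomposable_unique_minimal (R : realType) (n : nat) (prec : rel 'I_n)
    (l r : 'I_n -> R) (a b : 'I_n -> nat) :
  endpoint_levels prec l r a b ->
  unique (minimal_integral_hilbert_basis (length_cone prec l r))
    (indecomposable_basis prec l r).
Proof.
move=> lev; set B := indecomposable_basis prec l r.
have HB := indecomposable_hilbert_basis lev.
have least B' : integral_hilbert_basis (length_cone prec l r) B' ->
    (B `<=` B')%fset.
  move=> HB'; apply/fsubsetP => v /imfsetP[T /= + ->]; rewrite inE => /asboolP.
  exact: indecomposable_in_basis lev HB'.
split; first split=> // B' HB' B'B.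
  by apply/eqP; rewrite eqEfsubset B'B least.
by move=> B' [HB' minB']; apply: minB' HB (least _ HB').
Qed.

Theorem theorem6p2 (R : realType) (n : nat) (prec : rel 'I_n)
    (l r : 'I_n -> R) (S : {set 'I_n}) :
  interval_order R prec ->
  canonical_representation prec l r ->
  fundamental_extender prec l r S ->
  (hilbert_set prec l r S <->
   ~ (exists F : {set {set 'I_n}},
        finset.partition F S /\
        (forall T, T \in F -> fundamental_extender prec l r T /\ T \proper S))).
Proof.
move=> _ /canonical_endpoint_levels[a [b lev]] ES.
have uniqB := indecomposable_unique_minimal lev.
split=> [[_ [B [[minB _] SB]]]|indS].
  move: SB; rewrite -(uniqB.2 B minB) => /char_vector_in_basis.
  by case.
by split=> //; exists (indecomposable_basis prec l r); split=> //;
  apply/char_vector_in_basis.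
Qed.
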